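(* Let $n \ge 1$ be an integer, let $a^1, \ldots, a^n, b \in \mathbb{R}^{\mathbb{N}}$ be real sequences and let $\phi \in \mathbb{R}^n$. Consider the three optimization problems (SILP), (DSILP) and (FDSILP) associated with this data and the index set $I = \mathbb{N}$: (SILP): $\inf_{x \in \mathbb{R}^n} \phi^\top x$ subject to $\sum_{k=1}^n a^k(i) x_k \ge b(i)$ for all $i \in \mathbb{N}$; (DSILP): $\sup \langle b, \psi\rangle$ subject to $A'(\psi) = \phi$ and $\psi \in (\mathbb{R}^{\mathbb{N}}_+)'$; (FDSILP): $\sup \sum_{i \in \mathbb{N}} b(i) v(i)$ subject to $\sum_{i \in \mathbb{N}} a^k(i) v(i) = \phi_k$ for $k = 1, \ldots, n$ and $v \in \mathbb{R}^{(\mathbb{N})}_+$. Let $v(\mathrm{SILP})$, $v(\mathrm{DSILP})$, $v(\mathrm{FDSILP})$ denote their optimal values. Then $v(\mathrm{SILP}) = v(\mathrm{DSILP})$ if and only if $v(\mathrm{SILP}) = v(\mathrm{FDSILP})$.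
   Context: $\mathbb{N} = \{1,2,3,\ldots\}$. $\mathbb{R}^{\mathbb{N}}$ is the vector space of all real sequences, and $\mathbb{R}^{\mathbb{N}}_+$ is the cone of $u \in \mathbb{R}^{\mathbb{N}}$ with $u(i) \ge 0$ for all $i$. $\mathbb{R}^{(\mathbb{N})}$ is the subspace of sequences $v$ whose support $\{i : v(i) \ne 0\}$ is finite, and $\mathbb{R}^{(\mathbb{N})}_+$ is the cone of $v \in \mathbb{R}^{(\mathbb{N})}$ with $v(i) \ge 0$ for all $i$. For a real vector space $Y$, $Y'$ denotes its algebraic dual (all linear functionals $Y \to \mathbb{R}$, no continuity required), and $\langle y, \psi\rangle = \psi(y)$ for $\psi \in Y'$, $y \in Y$. For a convex cone $P \subseteq Y$, the algebraic dual cone is $P' = \{\psi \in Y' : \langle y, \psi\rangle \ge 0 \text{ for all } y \in P\}$. In particular $(\mathbb{R}^{\mathbb{N}}_+)' \subseteq (\mathbb{R}^{\mathbb{N}})'$. $A : \mathbb{R}^n \to \mathbb{R}^{\mathbb{N}}$ is the linear map $A(x) = (a^1(i) x_1 + \cdots + a^n(i) x_n)_{i \in \mathbb{N}}$, and $A' : (\mathbb{R}^{\mathbb{N}})' \to (\mathbb{R}^n)'$ is its algebraic adjoint $A'(\psi) = \psi \circ A$. With $(\mathbb{R}^n)'$ identified with $\mathbb{R}^n$, the constraint $A'(\psi) = \phi$ means $\langle a^k, \psi\rangle = \phi_k$ for $k = 1, \ldots, n$. Optimal values are taken in $[-\infty, +\infty]$, with the infimum over an empty feasible set equal to $+\infty$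 and the supremum over an empty feasible set equal to $-\infty$. *)

(* Defs.v *)
From HB Require Import structures.
From mathcomp Require Import all_boot all_order all_algebra.
From mathcomp Require Import all_classical all_reals all_analysis.

Set Implicit Arguments.
Unset Strict Implicit.
Unset Printing Implicit Defensive.

Import Order.TTheory GRing.Theory Num.Theory.

Local Open Scope classical_set_scope.
Local Open Scope ring_scope.

(* Sequences are indexed by nat, starting at 0 instead of 1.  R^o is R seen as
   a module over itself, so that realseq R is a vector space with the
   pointwise operations. *)
Definition realseq (R : realType) : lmodType R := nat -> R^o.

Definition seq_cone (R : realType) : set (realseq R) :=
  [set u | forall i, 0 <= u i].

Definition finsupp_cone (R : realType) : set (realseq R) :=
  [set v | finite_set [set i | v i != 0] /\ forall i, 0 <= v i].

(* {scalar Y} is the type of all linear functionals on Y, with no continuity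
   requirement: it is the algebraic dual of Y. *)
Definition dual_cone (R : realType) (Y : lmodType R) (P : set Y) :
    set {scalar Y} :=
  [set psi | forall y, P y -> 0 <= psi y].

(* phi^T x; dotp phi is also the functional on R^n identified with phi. *)
Definition dotp (R : realType) (n : nat) (phi x : 'cV[R]_n) : R :=
  \sum_(k < n) phi k 0 * x k 0.

Definition constraint_map (R : realType) (n : nat) (a : 'I_n -> realseq R)
    (x : 'cV[R]_n) : realseq R :=
  fun i => \sum_(k < n) a k i * x k 0.

Lemma constraint_map_is_linear (R : realType) (n : nat)
    (a : 'I_n -> realseq R) : linear (constraint_map a).
Proof.
move=> c x y; apply/funext => i.
have -> : (c *: constraint_map a x + constraint_map a y) i
  = c * constraint_map a x i + constraint_map a y i by [].
rewrite /constraint_map mulr_sumr -big_split /=.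
by apply: eq_bigr => k _; rewrite !mxE mulrDr mulrCA.
Qed.

HB.instance Definition _ (R : realType) (n : nat) (a : 'I_n -> realseq R) :=
  GRing.isLinear.Build R 'cV[R]_n (realseq R) *:%R (constraint_map a)
    (constraint_map_is_linear a).

Definition adjoint (R : realType) (X Y : lmodType R) (A : {linear X -> Y})
    (psi : {scalar Y}) : {scalar X} := psi \o A.

(* ereal_inf set0 = +oo and ereal_sup set0 = -oo. *)
Definition val_SILP (R : realType) (n : nat) (a : 'I_n -> realseq R)
    (b : realseq R) (phi : 'cV[R]_n) : \bar R :=
  ereal_inf [set (dotp phi x)%:E |
    x in [set x : 'cV[R]_n | forall i, b i <= constraint_map a x i]].

Definition val_DSILP (R : realType) (n : nat) (a : 'I_n -> realseq R)
    (b : realseq R) (phi : 'cV[R]_n) : \bar R :=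
  ereal_sup [set (psi b)%:E |
    psi in [set psi : {scalar realseq R} |
      adjoint (constraint_map a) psi =1 dotp phi /\
      dual_cone (@seq_cone R) psi]].

(* \sum_(i \in setT) F i is the sum of F over its support when that is finite,
   as is the case below for v in finsupp_cone. *)
Definition val_FDSILP (R : realType) (n : nat) (a : 'I_n -> realseq R)
    (b : realseq R) (phi : 'cV[R]_n) : \bar R :=
  ereal_sup [set (\sum_(i \in [set: nat]) (b i * v i : R))%:E |
    v in [set v : realseq R |
      (forall k, \sum_(i \in [set: nat]) (a k i * v i : R) = phi k 0) /\
      finsupp_cone v]].

(* Main.v *)
Require Import Defs.
From HB Require Import structures.
From mathcomp Require Import all_boot all_order all_algebra.
From mathcomp Require Import all_classical all_reals all_analysis.

(** The two dual problems are the same problem, so their values agree and the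
    equivalence is immediate.  The reason is that on the space of all real
    sequences a positive linear functional [psi], even with no continuity
    assumed, is the pairing with a finitely supported nonnegative sequence.

    The heart is [dual_cone_null_tail]: [psi] vanishes on the nonnegative
    sequences supported in some tail [N, +oo).  Otherwise every tail carries a
    nonnegative sequence [y N] with [psi (y N) = 1].  At each index only
    finitely many [y N] are nonzero, so the infinite sum of the [y N] is again
    a real sequence; it dominates all partial sums, so [psi] would take at it a
    value larger than every natural number.  Here it matters that the space
    contains all sequences, with no growth restriction.

    Splitting a sequence into positive and negative parts, [psi] vanishes on
    every sequence supported in that tail, hence [psi y] depends on the first
    [N] entries of [y] alone and the weights are the values of [psi] at the
    unit sequences ([dual_cone_finsupp]).  Conversely, pairing with a finitely
    supported nonnegative sequence is a positive functional
    ([finsupp_dual_cone]).  The correspondence preserves the objective and,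
    since an equality of functionals on R^n may be tested on the standard basis
    ([adjoint_eq_dotp]), the constraints as well. *)

Set Implicit Arguments.
Unset Strict Implicit.
Unset Printing Implicit Defensive.

Import Order.TTheory GRing.Theory Num.Theory.

Local Open Scope classical_set_scope.
Local Open Scope ring_scope.

Lemma realseq_sumE (R : realType) (I : Type) (r : seq I) (P : pred I)
    (F : I -> realseq R) (i : nat) :
  (\sum_(j <- r | P j) F j) i = \sum_(j <- r | P j) F j i.
Proof. by elim/big_rec2: _ => // j x y _ <-. Qed.

Definition unit_seq (R : realType) (i : nat) : realseq R :=
  fun j => (j == i)%:R.

(** The truncation at [N] makes the pairing linear in [y] for every [v]; it is
    the full pairing as soon as [v] vanishes from [N] on. *)
Definition pairing (R : realType) (N : nat) (v y : realseq R) : R :=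
  \sum_(i < N) y i * v i.

Lemma pairing_is_scalar (R : realType) (N : nat) (v : realseq R) :
  scalar (pairing N v).
Proof.
move=> c x y; rewrite /pairing mulr_sumr -big_split /=.
by apply: eq_bigr => i _; rewrite mulrA -mulrDl.
Qed.

HB.instance Definition _ (R : realType) (N : nat) (v : realseq R) :=
  GRing.isLinear.Build R (realseq R) R *%R (pairing N v)
    (pairing_is_scalar N v).

Lemma fsum_pairing (R : realType) (N : nat) (v y : realseq R) :
  (forall i, (N <= i)%N -> v i = 0) ->
  \sum_(i \in [set: nat]) (y i * v i : R) = pairing N v y.
Proof.
move=> v0; rewrite /pairing (fsbig_ord _ N (fun i => y i * v i : R)).
apply/esym/fsbig_widen => // i [_ /negP]; rewrite -leqNgt => /v0 /= ->.
exact: mulr0.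
Qed.

Lemma finsupp_cone_bounded (R : realType) (v : realseq R) :
  finsupp_cone v -> exists N, forall i, (N <= i)%N -> v i = 0.
Proof.
move=> [/finite_seqP[X suppX] _].
exists (\max_(i <- X) i).+1 => i Ni; apply/eqP; apply: contraTT Ni => vi.
have Xi : i \in X by have : [set i | v i != 0] i by []; rewrite suppX.
by rewrite -leqNgt; apply: leq_bigmax_seq.
Qed.

(** If every tail carried a nonnegative sequence on which [psi] is positive,
    a locally finite sum of such sequences, normalised to value 1, would have a
    value above every natural number. *)
Lemma dual_cone_null_tail (R : realType) (psi : {scalar realseq R}) :
  dual_cone (@seq_cone R) psi ->
  exists N, forall y : realseq R, seq_cone y ->
    (forall i, (i < N)%N -> y i = 0) -> psi y = 0.
Proof.
move=> psi_ge0; apply/not_existsP => no_tail.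
have /choice[y yP] N : exists y : realseq R,
    [/\ seq_cone y, forall i, (i < N)%N -> y i = 0 & psi y = 1].
  have /existsNP[y /not_implyP[y_ge0 /not_implyP[y0 /eqP psi_y]]] := no_tail N.
  exists ((psi y)^-1 *: y); split.
  - by move=> i; apply: mulr_ge0; [rewrite invr_ge0; apply: psi_ge0|].
  - by move=> i iN; change ((psi y)^-1 * y i = 0); rewrite y0 ?mulr0.
  - by rewrite linearZ/= mulVf.
(* At index i only the y N with N <= i can be nonzero, so u is the pointwise
   sum of all the y N. *)
pose u : realseq R := fun i => \sum_(N < i.+1) y N i.
have psi_u K : K%:R <= psi u.
  (* u dominates the sum of the first K of the y N, on which psi equals K *)
  have <- : psi (\sum_(N < K) y N) = K%:R.
    rewrite linear_sum (eq_bigr (fun=> 1)) => [|N _]; last by case: (yP N).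
    by rewrite sumr_const card_ord.
  rewrite -subr_ge0 -linearB; apply: psi_ge0 => i.
  change (0 <= u i - (\sum_(N < K) y N) i); rewrite realseq_sumE subr_ge0.
  rewrite /u -(big_mkord xpredT (fun N => y N i)).
  rewrite -(big_mkord xpredT (fun N => y N i)).
  have y_ge0 N : 0 <= y N i by case: (yP N) => + _ _; apply.
  (* both sums are compared with the one over N < max (K, i.+1): it exceeds
     the sum over N <= i by terms that vanish *)
  have -> : \sum_(0 <= N < i.+1) y N i = \sum_(0 <= N < maxn K i.+1) y N i.
    rewrite [RHS](big_cat_nat (leq0n _) (leq_maxr K i.+1))/=.
    rewrite [X in _ = _ + X]big_nat_cond [X in _ = _ + X]big1 ?addr0//.
    by move=> N /andP[/andP[iN _] _]; case: (yP N) => _ + _; apply.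
  rewrite [leRHS](big_cat_nat (leq0n _) (leq_maxl K i.+1))/= lerDl.
  exact: sumr_ge0.
have := psi_u (Num.truncn (psi u)).+1; rewrite leNgt.
by rewrite truncnS_gt.
Qed.

(** Past the support bound of [dual_cone_null_tail] a sequence is the
    difference of two nonnegative ones, both in the kernel of [psi]; the
    remaining part is a combination of finitely many unit sequences. *)
Lemma dual_cone_finsupp (R : realType) (psi : {scalar realseq R}) :
  dual_cone (@seq_cone R) psi ->
  exists2 v : realseq R, finsupp_cone v &
    forall y, psi y = \sum_(i \in [set: nat]) (y i * v i : R).
Proof.
move=> psi_ge0; have [N psi_tail] := dual_cone_null_tail psi_ge0.
pose v : realseq R := fun i => if (i < N)%N then psi (unit_seq R i) else 0.
have v0 i : (N <= i)%N -> v i = 0 by rewrite /v leqNgt => /negbTE ->.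
exists v => [|y].
  split=> [|i].
    apply: (sub_finite_set _ (finite_II N)) => i /= vi.
    by rewrite ltnNge; apply: contra_neqN vi => /v0.
  rewrite /v; case: ifP => // _; apply: psi_ge0 => j; exact: ler0n.
rewrite (fsum_pairing _ v0) /pairing.
(* tail 1 and tail (-1) are the positive and negative parts of y beyond N. *)
pose tail (s : R) : realseq R :=
  fun i => if (i < N)%N then 0 else Num.max (s * y i) 0.
have tail0 s : psi (tail s) = 0.
  apply: psi_tail => i; rewrite /tail; last by move=> ->.
  by case: ifP => // _; rewrite le_max lexx orbT.
have {1}-> : y = \sum_(i < N) y i *: unit_seq R i + (tail 1 - tail (-1)).
  apply/funext => i.
  change (y i =
    (\sum_(j < N) y j *: unit_seq R j) i + (tail 1 i - tail (-1) i)).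
  rewrite realseq_sumE /tail mul1r mulN1r.
  rewrite (eq_bigr (fun j : 'I_N => if i == j then y j else 0)); last first.
    move=> j _; change (y j * (i == j)%:R = if i == j :> nat then y j else 0).
    by case: (i == j :> nat); rewrite ?mulr1 ?mulr0.
  case: ltnP => iN.
    rewrite (bigD1 (Ordinal iN))//= eqxx big1 ?addr0 ?subr0 ?addr0//.
    by move=> j; rewrite -val_eqE/= eq_sym => /negbTE ->.
  rewrite big1 ?add0r => [|j _]; last by rewrite gtn_eqF// (leq_trans _ iN).
  case: (leP 0 (y i)) => yi.
    by rewrite (max_idPr _) ?subr0// oppr_le0.
  by rewrite (max_idPl _) ?sub0r ?opprK// oppr_ge0 ltW.
rewrite linearD linearB /= !tail0 subr0 addr0 linear_sum /=.
by apply: eq_bigr => i _; rewrite linearZ /v ltn_ord.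
Qed.

Lemma finsupp_dual_cone (R : realType) (v : realseq R) :
  finsupp_cone v ->
  exists2 psi : {scalar realseq R}, dual_cone (@seq_cone R) psi &
    forall y, psi y = \sum_(i \in [set: nat]) (y i * v i : R).
Proof.
move=> v_cone; have [N v0] := finsupp_cone_bounded v_cone.
exists (pairing N v) => y; last by rewrite (fsum_pairing _ v0).
by move=> y_ge0; apply: sumr_ge0 => i _; apply: mulr_ge0; case: v_cone.
Qed.

(** A functional on R^n is determined by its values on the standard basis,
    which [constraint_map a] sends to the sequences [a k]. *)
Lemma adjoint_eq_dotp (R : realType) (n : nat) (a : 'I_n -> realseq R)
    (phi : 'cV[R]_n) (psi : {scalar realseq R}) :
  adjoint (constraint_map a) psi =1 dotp phi <->
  forall k, psi (a k) = phi k 0.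
Proof.
have psiA x : adjoint (constraint_map a) psi x = \sum_k psi (a k) * x k 0.
  have -> : adjoint (constraint_map a) psi x = psi (\sum_k x k 0 *: a k).
    congr (psi _); apply/funext => i; rewrite realseq_sumE.
    by apply: eq_bigr => k _; rewrite mulrC.
  by rewrite linear_sum; apply: eq_bigr => k _; rewrite linearZ mulrC.
have pick (c : 'I_n -> R) k :
    \sum_j c j * (delta_mx k 0 : 'cV[R]_n) j 0 = c k.
  rewrite (bigD1 k)//= mxE !eqxx mulr1 big1 ?addr0// => j /negbTE jk.
  by rewrite mxE jk mulr0.
split=> [eq_psi k|eq_psi x].
  rewrite -(pick (fun k => psi (a k)) k) -psiA eq_psi.
  exact: (pick (fun k => phi k 0)).
by rewrite psiA; apply: eq_bigr => k _; rewrite eq_psi.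
Qed.

Lemma val_DSILP_FDSILP (R : realType) (n : nat) (a : 'I_n -> realseq R)
    (b : realseq R) (phi : 'cV[R]_n) :
  val_DSILP a b phi = val_FDSILP a b phi.
Proof.
congr ereal_sup; apply/seteqP; split => r /=.
  move=> [psi [/adjoint_eq_dotp psi_a /dual_cone_finsupp[v v_cone psiE]] <-].
  exists v; last by rewrite psiE.
  by split=> // k; rewrite -psiE.
move=> [v [v_a /finsupp_dual_cone[psi psi_cone psiE]] <-].
exists psi; last by rewrite psiE.
by split=> //; apply/adjoint_eq_dotp => k; rewrite psiE.
Qed.

Theorem theorem2p4 (R : realType) (n : nat) (n_ge1 : (1 <= n)%N)
    (a : 'I_n -> realseq R) (b : realseq R) (phi : 'cV[R]_n) :
  val_SILP a b phi = val_DSILP a b phi <->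
  val_SILP a b phi = val_FDSILP a b phi.
Proof. by rewrite val_DSILP_FDSILP. Qed.
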